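(* Any two variants of the extended bicyclic semigroup $\mathscr{C}_{\mathbb{Z}}$ are isomorphic; that is, for all integers $m,n,s,t$ the semigroups $\mathscr{C}_{\mathbb{Z}}^{m,n}$ and $\mathscr{C}_{\mathbb{Z}}^{s,t}$ are isomorphic.
   Context: The extended bicyclic semigroup $\mathscr{C}_{\mathbb{Z}}$ is the set $\mathbb{Z}\times\mathbb{Z}$ with the associative operation $(a,b)\cdot(c,d)=(a-b+c,d)$ if $b<c$; $(a,d)$ if $b=c$; $(a,d+b-c)$ if $b>c$. For integers $m,n$, the variant $\mathscr{C}_{\mathbb{Z}}^{m,n}$ is the set $\mathbb{Z}\times\mathbb{Z}$ with the semigroup operation $(a,b)\ast_{m,n}(c,d)=(a,b)\cdot(m,n)\cdot(c,d)$. *)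

(* Defs.v *)
From HB Require Import structures.
From mathcomp Require Import all_boot all_order all_algebra.
From mathcomp Require Import zify.

Set Implicit Arguments.
Unset Strict Implicit.
Unset Printing Implicit Defensive.

Import Order.TTheory GRing.Theory Num.Theory.

Local Open Scope ring_scope.

(* A named copy of int * int, so that its product is not confused with any
   componentwise structure on pairs. *)
Definition ext_bicyclic : Type := (int * int)%type.

Definition ext_bicyclic_mul (x y : ext_bicyclic) : ext_bicyclic :=
  let: (a, b) := x in
  let: (c, d) := y in
  if b < c then (a - b + c, d)
  else if b == c then (a, d)
  else (a, d + b - c).

Lemma ext_bicyclic_mulA : associative ext_bicyclic_mul.
Proof.
move=> [a b] [c d] [e f]; rewrite /ext_bicyclic_mul.
by repeat (case: ifP => ?); (congr pair; lia) || lia.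
Qed.

HB.instance Definition _ := Choice.copy ext_bicyclic (int * int)%type.
HB.instance Definition _ :=
  isSemigroup.Build ext_bicyclic ext_bicyclic_mulA.

(* The variant of S with respect to a : the carrier of S with the sandwich
   product x * a * y. The parameter a only serves to select that product. *)
Definition variant (S : semigroupType) (a : S) : Type := S.

Definition variant_mul (S : semigroupType) (a : S) (x y : variant a) :
  variant a := ((x : S) * a * (y : S))%g.

Lemma variant_mulA (S : semigroupType) (a : S) : associative (@variant_mul S a).
Proof. by move=> x y z; rewrite /variant_mul !mulgA. Qed.

HB.instance Definition _ (S : semigroupType) (a : S) :=
  Choice.copy (variant a) S.
HB.instance Definition _ (S : semigroupType) (a : S) :=
  isSemigroup.Build (variant a) (@variant_mulA S a).

Definition ext_bicyclic_variant (m n : int) : semigroupType :=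
  variant ((m, n) : ext_bicyclic).

Definition semigroup_isomorphic (S T : semigroupType) : Prop :=
  exists f : {multiplicative S -> T}, bijective f.

(* Main.v *)
(* Writing the product of the extended bicyclic semigroup as
   (a, b)(c, d) = (a - b + M, d - c + M) with M = max(b, c), the product in the
   variant by (m, n) is (a - b + m - n + M, d - c + M) with
   M = max(b + n - m, n, c). The translation by (t - n, s - m) shifts M by
   t - n when (m, n) is replaced by (s, t), so it is an isomorphism. *)
Require Import Defs.
From mathcomp Require Import all_boot all_order all_algebra.
From HB Require Import structures.
From mathcomp Require Import zify.

Import GRing.Theory.
Local Open Scope ring_scope.

Definition ext_bicyclic_shift (p q : int) (x : ext_bicyclic) : ext_bicyclic :=
  (x.1 + p, x.2 + q).

Lemma ext_bicyclic_shift_bij (p q : int) : bijective (ext_bicyclic_shift p q).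
Proof.
exists (ext_bicyclic_shift (- p) (- q)) => -[a b];
  by rewrite /ext_bicyclic_shift /= ?addrK ?addrNK.
Qed.

(** The shifts are crossed because the product compares the second coordinate of [x] with [m] and
    the first coordinate of [y] with [n]; moved this way, every comparison keeps its outcome. *)
Lemma ext_bicyclic_shift_sandwich (m n s t : int) (x y : ext_bicyclic) :
  let f := ext_bicyclic_shift (t - n) (s - m) in
  f (ext_bicyclic_mul (ext_bicyclic_mul x (m, n)) y) =
  ext_bicyclic_mul (ext_bicyclic_mul (f x) (s, t)) (f y).
Proof.
case: x y => [a b] [c d]; rewrite /ext_bicyclic_shift /ext_bicyclic_mul /=.
(* Branches where the two sides compare differently have contradictory hypotheses. *)
by repeat (case: ifP => ? /=); (congr pair; lia) || lia.
Qed.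

Theorem theorem2p8 (m n s t : int) :
  semigroup_isomorphic (ext_bicyclic_variant m n) (ext_bicyclic_variant s t).
Proof.
pose f : ext_bicyclic_variant m n -> ext_bicyclic_variant s t :=
  ext_bicyclic_shift (t - n) (s - m).
have fM : {morph f : x y / (x * y)%g}.
  (* Both variant products unfold to sandwiches of [ext_bicyclic_mul]. *)
  exact: ext_bicyclic_shift_sandwich.
pose fMult := isMultiplicative.Build _ _ f fM.
pose F : {multiplicative ext_bicyclic_variant m n -> ext_bicyclic_variant s t} :=
  HB.pack f fMult.
by exists F; apply: ext_bicyclic_shift_bij.
Qed.
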